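(* Let $(A,\leq,{}',0,1)$ be a finite orthomodular poset, $(T,R)$ a time frame and $X,Y,Z\in\{P,F,H,G\}$. Then: (i) Put $i:=1$ if $Z\in\{H,G\}$ and $i:=2$ otherwise, and assume $X(\varphi(x))\odot Y(q)\leq_iZ(\varphi(x\odot q))$ for all $x\in(2^A\setminus\{\emptyset\})^T$ and all $q\in A^T$. Then $X(\varphi(p\rightarrow q))\sqsubseteq Y(p)\rightarrow Z(q)$ for all $p,q\in A^T$. (ii) Put $i:=1$ if $X\in\{H,G\}$ and $i:=2$ otherwise, and assume $X(\varphi(p\rightarrow x))\leq_iY(p)\rightarrow Z(\varphi(x))$ for all $p\in A^T$ and all $x\in(2^A\setminus\{\emptyset\})^T$. Then $X(p)\odot Y(q)\sqsubseteq Z(\varphi(p\odot q))$ for all $p,q\in A^T$.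
   Context: An orthomodular poset is a bounded poset $(A,\leq,0,1)$ with a unary operation ${}'$ that is an antitone involution ($a\leq b\Rightarrow b'\leq a'$, $a''=a$) and a complementation ($a\vee a'=1$, $a\wedge a'=0$), such that (i) if $x\leq y'$ then $x\vee y$ exists, and (ii) if $x\leq y$ then $y=x\vee(y\wedge x')$. For $B\subseteq A$: $L(B)$, $U(B)$ are the sets of lower and upper bounds of $B$; $\operatorname{Max}B$, $\operatorname{Min}B$ the sets of maximal and minimal elements. For $a\in A$, $B\subseteq A$: $a\vee B=\{a\vee b\mid b\in B\}$, $B\wedge a=\{b\wedge a\mid b\in B\}$. Connectives: for $a,b\in A$, $a\odot b:=\operatorname{Min}U(\{a,b'\})\wedge b$ and $a\rightarrow b:=a'\vee\operatorname{Max}L(\{a,b\})$ (always defined, nonempty subsets of $A$); for nonempty $B,C\subseteq A$, $B\odot C=\bigcup\{b\odot c\mid b\in B,c\in C\}$, $B\rightarrow C=\bigcup\{b\rightarrow c\mid b\in B,c\in C\}$; for $x,y\in(2^A\setminus\{\emptyset\})^T$, $(x\odot y)(t)=x(t)\odot y(t)$, $(x\rightarrow y)(t)=x(t)\rightarrow y(t)$; elements $a$ are identified with $\{a\}$ and $p\in A^T$ with $t\mapsto\{p(t)\}$. A time frame is $(T,R)$ with $T\neq\emptyset$, $R\subseteq T^2$ serial (each $s$ has some $r\mathrel Rs$ and some $s\mathrel Rt$). Tense operators: for nonempty $B\subseteq A^T$ (with $q\in A^T$ identified with $\{q\}$) and $s\in T$: $P(B)(s)=\operatorname{Min}U(\{q(t)\mid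 q\in B,t\mathrel Rs\})$, $F(B)(s)=\operatorname{Min}U(\{q(t)\mid q\in B,s\mathrel Rt\})$, $H(B)(s)=\operatorname{Max}L(\{q(t)\mid q\in B,t\mathrel Rs\})$, $G(B)(s)=\operatorname{Max}L(\{q(t)\mid q\in B,s\mathrel Rt\})$. $\varphi(x)=\{q\in A^T\mid q(t)\in x(t)\ \forall t\}$ for $x\in(2^A\setminus\{\emptyset\})^T$. For nonempty $B,C\subseteq A$: $B\leq_1C$ iff $\forall b\in B\,\exists c\in C: b\leq c$; $B\leq_2C$ iff $\forall c\in C\,\exists b\in B: b\leq c$; $B\sqsubseteq C$ iff $\exists b\in B,c\in C: b\leq c$. These relations are extended to $(2^A\setminus\{\emptyset\})^T$ pointwise (for all $t\in T$). *)

(* Defs.v *)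
From HB Require Import structures.
From mathcomp Require Import all_boot all_order.
From mathcomp Require Import boolp classical_sets.

Set Implicit Arguments.
Unset Strict Implicit.
Unset Printing Implicit Defensive.

Local Open Scope order_scope.
Local Open Scope classical_set_scope.

Section OrthomodularPosets.
Context {d : Order.disp_t} {A : tbPOrderType d}.
Implicit Types (a b x y : A) (B C : set A).

(* Binary joins and meets need not exist in A: "z is the join (meet) of x and
   y" is the relation supremums [set x; y] z (infimums [set x; y] z). *)
Record orthomodular (c : A -> A) : Prop := Orthomodular {
  om_antitone : forall x y, x <= y -> c y <= c x;
  om_involutive : forall x, c (c x) = x;
  om_join_compl : forall x, supremums [set x; c x] \top;
  om_meet_compl : forall x, infimums [set x; c x] \bot;
  om_join_exists : forall x y, x <= c y -> supremums [set x; y] !=set0;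
  om_law : forall x y, x <= y ->
    exists2 m, infimums [set y; c x] m & supremums [set x; m] y }.

(* Maximal and minimal elements; the library's maximums and minimums are
   greatest and least elements. *)
Definition Max B : set A := [set x | B x /\ forall y, B y -> x <= y -> y = x].
Definition Min B : set A := [set x | B x /\ forall y, B y -> y <= x -> y = x].

Definition join_set a B : set A :=
  [set z | exists2 b, B b & supremums [set a; b] z].
Definition meet_set B a : set A :=
  [set z | exists2 b, B b & infimums [set b; a] z].

Definition odot (c : A -> A) a b : set A :=
  meet_set (Min (ubound [set a; c b])) b.
Definition imp (c : A -> A) a b : set A :=
  join_set (c a) (Max (lbound [set a; b])).

Definition sodot (c : A -> A) B C : set A :=
  [set z | exists b e, [/\ B b, C e & odot c b e z]].
Definition simp (c : A -> A) B C : set A :=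
  [set z | exists b e, [/\ B b, C e & imp c b e z]].

Definition le1 B C : Prop := forall b, B b -> exists2 e, C e & b <= e.
Definition le2 B C : Prop := forall e, C e -> exists2 b, B b & b <= e.
Definition sqle B C : Prop := exists b e, [/\ B b, C e & b <= e].

End OrthomodularPosets.

Record time_frame (T : Type) (R : T -> T -> Prop) : Prop := TimeFrame {
  tf_inhabited : inhabited T;
  tf_serial_past : forall s, exists r, R r s;
  tf_serial_future : forall s, exists t, R s t }.

Inductive tense := opP | opF | opH | opG.

Section TenseOperators.
Context {d : Order.disp_t} {A : tbPOrderType d} {T : Type}.
Implicit Types (c : A -> A) (p q : T -> A) (x y : T -> set A).

Definition fodot c x y : T -> set A := fun t => sodot c (x t) (y t).
Definition fimp c x y : T -> set A := fun t => simp c (x t) (y t).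

(* The identification of p in A^T with an element of (2^A \ {0})^T. *)
Definition fset1 p : T -> set A := fun t => [set p t].

Definition phi x : set (T -> A) := [set q | forall t, x t (q t)].

Definition past_values (R : T -> T -> Prop) (B : set (T -> A)) (s : T) : set A :=
  [set q t | q in B & t in [set t | R t s]].
Definition future_values (R : T -> T -> Prop) (B : set (T -> A)) (s : T) : set A :=
  [set q t | q in B & t in [set t | R s t]].

Definition tense_op (R : T -> T -> Prop) (X : tense) (B : set (T -> A)) :
    T -> set A := fun s =>
  match X with
  | opP => Min (ubound (past_values R B s))
  | opF => Min (ubound (future_values R B s))
  | opH => Max (lbound (past_values R B s))
  | opG => Max (lbound (future_values R B s))
  end.

Definition fle1 x y : Prop := forall t, le1 (x t) (y t).
Definition fle2 x y : Prop := forall t, le2 (x t) (y t).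
Definition fsqle x y : Prop := forall t, sqle (x t) (y t).

(* The relation <=_i, where i = 1 if X is H or G, and i = 2 if X is P or F. *)
Definition fle_for (X : tense) : (T -> set A) -> (T -> set A) -> Prop :=
  match X with
  | opH | opG => fle1
  | opP | opF => fle2
  end.

End TenseOperators.

(* Main.v *)
(** For orthogonal elements joins exist and the orthomodular law makes
    [a |-> b' \/ a] and [w |-> w /\ b] mutually inverse between the elements
    below [b] and those above [b']. Hence [a (.) b] meets the down-set of [u]
    exactly when [b -> u] meets the up-set of [a], while [(p -> q) (.) p] lies
    below [q] and [q -> (p (.) q)] lies above [p]. Monotonicity of the tense
    operators then turns the hypothesis, taken at [x = p -> q] resp.
    [x = p (.) q], into an inequality of the form required by this
    adjointness. *)
Require Import Defs.
From mathcomp Require Import all_boot all_order.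
From mathcomp Require Import boolp classical_sets.

Set Implicit Arguments.
Unset Strict Implicit.
Unset Printing Implicit Defensive.

Import Order.TTheory.
Local Open Scope order_scope.
Local Open Scope classical_set_scope.

(** * Joins and meets of pairs *)

Section Bounds.
Context {d : Order.disp_t} {A : porderType d}.
Implicit Types x y z u : A.

Lemma ubound2P x y u : ubound [set x; y] u <-> x <= u /\ y <= u.
Proof.
by split=> [h|[xu yu] v [] ->//]; split; apply: h; [left|right].
Qed.

Lemma lbound2P x y u : lbound [set x; y] u <-> u <= x /\ u <= y.
Proof.
by split=> [h|[xu yu] v [] ->//]; split; apply: h; [left|right].
Qed.

Lemma supremums2P x y z : supremums [set x; y] z <->
  [/\ x <= z, y <= z & forall u, x <= u -> y <= u -> z <= u].
Proof.
split=> [[/ubound2P[xz yz] zl]|[xz yz zl]].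
  by split=> // u xu yu; apply/zl/ubound2P.
by split; [apply/ubound2P|move=> u /ubound2P[]; exact: zl].
Qed.

Lemma infimums2P x y z : infimums [set x; y] z <->
  [/\ z <= x, z <= y & forall u, u <= x -> u <= y -> u <= z].
Proof.
split=> [[/lbound2P[xz yz] zl]|[xz yz zl]].
  by split=> // u xu yu; apply/zl/lbound2P.
by split; [apply/lbound2P|move=> u /lbound2P[]; exact: zl].
Qed.

End Bounds.

(** * Extremal elements in finite posets *)

Section Extremal.
Context {d : Order.disp_t} {A : finTBPOrderType d}.
Implicit Types (B : set A) (b : A).

(** Take, among the elements of [B] above [b], one whose principal down-set is largest in
    cardinality: any [y] in [B] above it has a down-set containing this one, hence equal to it. *)
Lemma Max_above B b : B b -> exists2 m, Max B m & b <= m.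
Proof.
move=> Bb; have Pb : `[< B b >] && (b <= b) by rewrite lexx andbT; apply/asboolP.
pose P i := `[< B i >] && (b <= i).
pose F i := #|[pred y : A | y <= i]|.
have [m /andP[/asboolP Bm bm] mmax] := @arg_maxnP _ b P F Pb.
exists m => //; split=> // y By my; apply/eqP; rewrite eq_le my andbT.
have Py : P y by rewrite /P (le_trans bm my) andbT; apply/asboolP.
have sub : [pred z : A | z <= m] \subset [pred z | z <= y].
  by apply/fintype.subsetP => z; rewrite !inE => /le_trans; apply.
have /fintype.subset_cardP /(_ sub) /(_ y) : F m = F y.
  by apply/eqP; rewrite eqn_leq subset_leq_card //=; exact: mmax.
by rewrite !inE lexx.
Qed.

End Extremal.

(** [Min] is, by conversion, [Max] in the dual order [A^d]. *)
Lemma Min_below (d : Order.disp_t) (A : finTBPOrderType d) (B : set A) (b : A) :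
  B b -> exists2 m, Min B m & m <= b.
Proof. exact: (@Max_above _ A^d). Qed.

Lemma Max_lbound_nonempty (d : Order.disp_t) (A : finTBPOrderType d)
    (B : set A) : Max (lbound B) !=set0.
Proof.
have [|m mmax _] := @Max_above _ A (lbound B) \bot; last by exists m.
by move=> b _; exact: le0x.
Qed.

Lemma Min_ubound_nonempty (d : Order.disp_t) (A : finTBPOrderType d)
    (B : set A) : Min (ubound B) !=set0.
Proof. exact: (@Max_lbound_nonempty _ A^d). Qed.

(** * Elementwise adjointness from the orthomodular law *)

Section Adjointness.
Context {d : Order.disp_t} {A : finTBPOrderType d} {c : A -> A}.
Hypothesis Ac : orthomodular c.
Implicit Types a b u w z : A.

Let antiC x y : x <= y -> c y <= c x. Proof. exact: om_antitone. Qed.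
Let cK x : c (c x) = x. Proof. exact: om_involutive. Qed.

Lemma compl_meet_exists b w : c b <= w -> infimums [set w; b] !=set0.
Proof. by move=> /(om_law Ac); rewrite cK => -[m wm _]; exists m. Qed.

Lemma compl_meet_join b w m :
  c b <= w -> infimums [set w; b] m -> supremums [set c b; m] w.
Proof.
move=> /(om_law Ac); rewrite cK => -[n wn nw] wm.
by rewrite (is_subset1_infimums wm wn).
Qed.

(** This is the complement of the orthomodular law for [c b <= c m]: the meet [n] of [c m] and [b]
    equals [c e] by De Morgan, and [c m] is the join of [c b] and [n]. *)
Lemma compl_join_meet b m e :
  m <= b -> supremums [set c b; m] e -> infimums [set e; b] m.
Proof.
move=> mb /supremums2P[be me el].
have [n mn] := compl_meet_exists (antiC mb).
have /supremums2P[_ _ ml] := compl_meet_join (antiC mb) mn.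
have /infimums2P[nm nb nl] := mn.
have ce_n : c e <= n by apply: nl; [exact: antiC|rewrite -[b]cK; exact: antiC].
apply/infimums2P; split=> // u ue ub; rewrite -[u]cK -[m]cK; apply: antiC.
apply: ml; first exact: antiC.
apply: le_trans (antiC ue); rewrite -[n]cK; apply: antiC.
by apply: el; [exact: antiC|rewrite -[m]cK; exact: antiC].
Qed.

(** The bound [e] controls which minimal upper bound is chosen: [\top] gives nonemptiness, while
    adjointness takes for [e] an element of [b -> u]. *)
Lemma odot_exists a b e : a <= e -> c b <= e ->
  exists w z, [/\ odot c a b z, w <= e & infimums [set w; b] z].
Proof.
move=> ae be.
have [w wmin we] : exists2 w, Min (ubound [set a; c b]) w & w <= e.
  by apply: Min_below; apply/ubound2P.
have [/ubound2P[_ bw] _] := wmin.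
have [z wz] := compl_meet_exists bw.
by exists w, z; split=> //; exists w.
Qed.

Lemma imp_exists b u z : z <= b -> z <= u ->
  exists m e, [/\ imp c b u e, z <= m & supremums [set c b; m] e].
Proof.
move=> zb zu.
have [m mmax zm] : exists2 m, Max (lbound [set b; u]) m & z <= m.
  by apply: Max_above; apply/lbound2P.
have [/lbound2P[mb _] _] := mmax.
have [e me] := om_join_exists Ac (antiC mb).
by exists m, e; split=> //; exists m.
Qed.

Lemma odot_nonempty a b : odot c a b !=set0.
Proof. by have [w [z []]] := odot_exists (lex1 a) (lex1 (c b)); exists z. Qed.

Lemma imp_nonempty a b : imp c a b !=set0.
Proof. by have [m [e []]] := imp_exists (le0x a) (le0x b); exists e. Qed.

(** Since [z] is the meet of some [w] with [b], the join of [c b] and [z] is [w] again. Enlarging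
    [z] to a maximal lower bound [m] of [b] and [u] only raises this join, so [a <= w <= e]. *)
Lemma odot_le_imp a b u z :
  odot c a b z -> z <= u -> exists2 e, imp c b u e & a <= e.
Proof.
move=> [w [/ubound2P[aw bw] _] wz] zu.
have /supremums2P[_ _ wl] := compl_meet_join bw wz.
have /infimums2P[_ zb _] := wz.
have [m [e [be zm /supremums2P[ce me _]]]] := imp_exists zb zu.
by exists e => //; apply: le_trans aw _; apply: wl => //; exact: le_trans me.
Qed.

(** Dually, [m] is the meet of [e] and [b], and shrinking [e] to a minimal upper bound [w] of [a]
    and [c b] only lowers this meet. *)
Lemma imp_ge_odot a b u e :
  imp c b u e -> a <= e -> exists2 z, odot c a b z & z <= u.
Proof.
move=> [m [/lbound2P[mb mu] _] me] ae.
have /supremums2P[be _ _] := me.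
have /infimums2P[_ _ ml] := compl_join_meet mb me.
have [w [z [abz we /infimums2P[zw zb _]]]] := odot_exists ae be.
by exists z => //; apply: le_trans mu; apply: ml => //; exact: le_trans we.
Qed.

Lemma imp_odot_le a b z w : imp c a b z -> odot c z a w -> w <= b.
Proof.
move=> [m [/lbound2P[ma mb] _] mz] [v [vub vmin] /infimums2P[wv wa _]].
have /supremums2P[az _ _] := mz.
have /infimums2P[_ _ ml] := compl_join_meet ma mz.
(* As [c a <= z], the only minimal upper bound of the two is [z], so [w] is the meet of [z] and [a],
   namely [m]. *)
have ub_z : ubound [set z; c a] z by apply/ubound2P.
apply: le_trans mb; apply: ml => //; rewrite (vmin z ub_z) //.
by have /ubound2P[] := vub.
Qed.

Lemma odot_imp_ge a b z w : odot c a b z -> imp c b z w -> a <= w.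
Proof.
move=> [v [/ubound2P[av bv] _] vz] [m [mlb mmax] /supremums2P[bw mw _]].
have /infimums2P[_ zb _] := vz.
have /supremums2P[_ _ vl] := compl_meet_join bv vz.
have /lbound2P[_ mz] := mlb.
(* As [z <= b], the only maximal lower bound of the two is [z], so [w] is the join of [c b] and [z],
   namely [v]. *)
have lb_z : lbound [set b; z] z by apply/lbound2P.
have zm : z <= m by rewrite (mmax z lb_z mz).
by apply: le_trans av _; apply: vl => //; exact: le_trans mw.
Qed.

End Adjointness.

(** * Passing from [le1] and [le2] to [sqle] along a change of bounded set *)

Lemma sqle_Min_ubound (d : Order.disp_t) (A : finTBPOrderType d)
    (D V W : set A) :
  le2 D (Min (ubound V)) -> le1 V W -> sqle D (Min (ubound W)).
Proof.
(* The chase starts on the right and descends: [u] also bounds [V], so it dominates a minimal upper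
   bound of [V], to which [le2] applies. *)
move=> DV VW; have [u umin] := Min_ubound_nonempty W.
have [e emin eu] : exists2 e, Min (ubound V) e & e <= u.
  apply: Min_below => v /VW[w Ww vw]; apply: le_trans vw _.
  by case: umin => + _; exact.
have [b Db be] := DV _ emin.
by exists b, u; split=> //; exact: le_trans eu.
Qed.

Lemma sqle_Max_lbound (d : Order.disp_t) (A : finTBPOrderType d)
    (D V W : set A) :
  D !=set0 -> le1 D (Max (lbound V)) -> le2 V W -> sqle D (Max (lbound W)).
Proof.
(* With [le1] the chase starts on the left instead, which is why [D] must be nonempty. *)
move=> [b Db] DV VW; have [e [el _] be] := DV _ Db.
have [u umax eu] : exists2 u, Max (lbound W) u & e <= u.
  by apply: Max_above => w /VW[v Vv]; apply: le_trans; exact: el.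
by exists b, u; split=> //; exact: le_trans eu.
Qed.

Lemma Max_lbound_sqle (d : Order.disp_t) (A : finTBPOrderType d)
    (D V W : set A) :
  le1 (Max (lbound V)) D -> le2 W V -> sqle (Max (lbound W)) D.
Proof.
move=> VD WV; have [//|b [u [? ? ?]]] := @sqle_Min_ubound _ A^d D V W VD.
by exists u, b.
Qed.

Lemma Min_ubound_sqle (d : Order.disp_t) (A : finTBPOrderType d)
    (D V W : set A) :
  D !=set0 -> le2 (Min (ubound V)) D -> le1 W V -> sqle (Min (ubound W)) D.
Proof.
move=> D0 VD WV; have [//|b [u [? ? ?]]] := @sqle_Max_lbound _ A^d D V W D0 VD.
by exists u, b.
Qed.

(** * Monotonicity of the tense operators *)

Section TenseMonotonicity.
Context {d : Order.disp_t} {A : finTBPOrderType d} {T : Type}.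
Variable R : T -> T -> Prop.
Implicit Types (B : set (T -> A)) (D : T -> set A) (p q f : T -> A).

(** For [opP] and [opF] every value from [B] must lie below a value of [q]; for [opH] and [opG]
    every value of [q] must lie above one from [B], and a fixed member [g] of [B] supplies it. *)
Lemma sqle_tense_op Z D B q s :
  B !=set0 -> (forall f t, B f -> f t <= q t) -> D s !=set0 ->
  fle_for Z D (tense_op R Z B) -> sqle (D s) (tense_op R Z [set q] s).
Proof.
move=> [g Bg] Bq D0; case: Z => /(_ s) /= DB.
- by apply: sqle_Min_ubound DB _ => _ [f Bf [t Rt <-]];
  exists (q t); [exists q => //; exists t|exact: Bq].
- by apply: sqle_Min_ubound DB _ => _ [f Bf [t Rt <-]];
  exists (q t); [exists q => //; exists t|exact: Bq].
- by apply: sqle_Max_lbound DB _ => // _ [_ -> [t Rt <-]];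
  exists (g t); [exists g => //; exists t|exact: Bq].
- by apply: sqle_Max_lbound DB _ => // _ [_ -> [t Rt <-]];
  exists (g t); [exists g => //; exists t|exact: Bq].
Qed.

Lemma tense_op_sqle X D B p s :
  B !=set0 -> (forall f t, B f -> p t <= f t) -> D s !=set0 ->
  fle_for X (tense_op R X B) D -> sqle (tense_op R X [set p] s) (D s).
Proof.
move=> [g Bg] pB D0; case: X => /(_ s) /= BD.
- by apply: Min_ubound_sqle BD _ => // _ [_ -> [t Rt <-]];
  exists (g t); [exists g => //; exists t|exact: pB].
- by apply: Min_ubound_sqle BD _ => // _ [_ -> [t Rt <-]];
  exists (g t); [exists g => //; exists t|exact: pB].
- by apply: Max_lbound_sqle BD _ => _ [f Bf [t Rt <-]];
  exists (p t); [exists p => //; exists t|exact: pB].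
- by apply: Max_lbound_sqle BD _ => _ [f Bf [t Rt <-]];
  exists (p t); [exists p => //; exists t|exact: pB].
Qed.

Lemma tense_op_nonempty X B s : tense_op R X B s !=set0.
Proof. by case: X; (exact: Min_ubound_nonempty || exact: Max_lbound_nonempty). Qed.

Lemma phi_nonempty (x : T -> set A) : (forall t, x t !=set0) -> phi x !=set0.
Proof. by move=> /choice[f xf]; exists f. Qed.

End TenseMonotonicity.

(** * Adjointness for sets and the two implications *)

Lemma sodot_nonempty (d : Order.disp_t) (A : finTBPOrderType d) (c : A -> A)
    (Ac : orthomodular c) (B C : set A) :
  B !=set0 -> C !=set0 -> sodot c B C !=set0.
Proof.
by move=> [a Ba] [b Cb]; have [z abz] := odot_nonempty Ac a b; exists z, a, b.
Qed.

Lemma simp_nonempty (d : Order.disp_t) (A : finTBPOrderType d) (c : A -> A)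
    (Ac : orthomodular c) (B C : set A) :
  B !=set0 -> C !=set0 -> simp c B C !=set0.
Proof.
by move=> [a Ba] [b Cb]; have [z abz] := imp_nonempty Ac a b; exists z, a, b.
Qed.

Lemma set_adjointness (d : Order.disp_t) (A : finTBPOrderType d) (c : A -> A)
    (Ac : orthomodular c) (B C D : set A) :
  sqle (sodot c B C) D <-> sqle B (simp c C D).
Proof.
split=> [[z [u [[a [b [Ba Cb abz]]] Du zu]]]|
         [a [e [Ba [b [u [Cb Du bue]]] ae]]]].
- have [e bue ae] := odot_le_imp Ac abz zu.
  by exists a, e; split=> //; exists b, u.
- have [z abz zu] := imp_ge_odot Ac bue ae.
  by exists z, u; split=> //; exists a, b.
Qed.

Theorem theorem15 (d : Order.disp_t) (A : finTBPOrderType d) (c : A -> A)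
    (Ac : orthomodular c) (T : Type) (R : T -> T -> Prop) (TR : time_frame R)
    (X Y Z : tense) :
  ((forall (x : T -> set A) (q : T -> A), (forall t, x t !=set0) ->
      fle_for Z
        (fodot c (tense_op R X (phi x)) (tense_op R Y [set q]))
        (tense_op R Z (phi (fodot c x (fset1 q))))) ->
   forall p q : T -> A,
     fsqle (tense_op R X (phi (fimp c (fset1 p) (fset1 q))))
           (fimp c (tense_op R Y [set p]) (tense_op R Z [set q])))
  /\
  ((forall (p : T -> A) (x : T -> set A), (forall t, x t !=set0) ->
      fle_for X
        (tense_op R X (phi (fimp c (fset1 p) x)))
        (fimp c (tense_op R Y [set p]) (tense_op R Z (phi x)))) ->
   forall p q : T -> A,
     fsqle (fodot c (tense_op R X [set p]) (tense_op R Y [set q]))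
           (tense_op R Z (phi (fodot c (fset1 p) (fset1 q))))).
Proof.
have nonempty1 (p : T -> A) t : fset1 p t !=set0 by exists (p t).
split=> hyp p q s.
- have x0 t : fimp c (fset1 p) (fset1 q) t !=set0 by exact: simp_nonempty.
  apply/(set_adjointness Ac); apply: sqle_tense_op (hyp _ p x0).
  + by apply: phi_nonempty => t; exact: sodot_nonempty.
  (* Each [f] in the set to which [Z] is applied takes values in [(p -> q) (.) p], hence lies below
     [q]. *)
  + move=> f t /(_ t)[z [_ [[_ [_ [-> -> pqz]]] -> zpf]]].
    exact: imp_odot_le pqz zpf.
  + by apply: sodot_nonempty => //; exact: tense_op_nonempty.
- have x0 t : fodot c (fset1 p) (fset1 q) t !=set0 by exact: sodot_nonempty.
  apply/(set_adjointness Ac); apply: tense_op_sqle (hyp q _ x0).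
  + by apply: phi_nonempty => t; exact: simp_nonempty.
  (* Here [f] takes values in [q -> (p (.) q)], hence lies above [p]. *)
  + move=> f t /(_ t)[_ [z [-> [_ [_ [-> -> pqz]]] qzf]]].
    exact: odot_imp_ge pqz qzf.
  + by apply: simp_nonempty => //; exact: tense_op_nonempty.
Qed.
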